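(* For every partition $\lambda\in Y$, $e_\alpha(\lambda)=I_\lambda$ and $e_\beta(\lambda)=a(\lambda)\,I_\lambda$.
   Context: $Y$ is Young's lattice: the poset of all integer partitions $\lambda=(\lambda_1\ge\lambda_2\ge\cdots)$ ordered by inclusion of Young diagrams (English notation), graded by $|\lambda|$, with minimum $\emptyset$; $\lambda\lessdot\mu$ iff the diagram of $\mu$ is obtained from that of $\lambda$ by adding one box. Put $a(\lambda)=(-1)^{\lambda_2+\lambda_4+\cdots}$ and $a(\mu/\lambda)=a(\lambda)a(\mu)$. For a cover $\lambda\lessdot\mu$ whose added box lies in row $i$, put $$s_\alpha(\lambda\lessdot\mu)=(-1)^{\lambda_1+\lambda_2+\cdots+\lambda_i},\qquad s_\beta(\lambda\lessdot\mu)=a(\mu/\lambda)\,s_\alpha(\lambda\lessdot\mu).$$ For $c\in\{\alpha,\beta\}$ and $\lambda$ with $|\lambda|=r$, the signed sum of chains is $$e_c(\lambda)=\sum s_c(\lambda^{(0)}\lessdot\lambda^{(1)})\,s_c(\lambda^{(1)}\lessdot\lambda^{(2)})\cdots s_c(\lambda^{(r-1)}\lessdot\lambda^{(r)}),$$ the sum being over all maximal chains $\emptyset=\lambda^{(0)}\lessdot\lambda^{(1)}\lessdot\cdots\lessdot\lambda^{(r)}=\lambda$ in $Y$. For a standard Young tableau $T$ of shape $\lambda$ (English notation), the reading word $r(T)$ is the permutation obtained by reading the entries of $T$ from right to left in each row, starting with the bottom row and going up. The sign $s(T)$ is the sign of the permutation $r(T)$. The sign-imbalance of $\lambda$ is $I_\lambda=\sum_T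 s(T)$, summed over all standard Young tableaux $T$ of shape $\lambda$. *)

(* Defs.v *)
From HB Require Import structures.
From mathcomp Require Import all_boot all_order all_algebra all_fingroup.

Set Implicit Arguments.
Unset Strict Implicit.
Unset Printing Implicit Defensive.

Import Order.TTheory GRing.Theory.

(* Rows, columns and parts are numbered from 0 throughout: the part written *)
(* lambda_i on paper is [nth 0 l i.-1], and [nth 0] pads with zeros. *)

Record intpart := IntPart {
  parts :> seq nat;
  _ : sorted geq parts && (0 \notin parts) }.

HB.instance Definition _ := [isSub for parts].
HB.instance Definition _ := [Countable of intpart by <:].

Implicit Types l m n : intpart.

Lemma part_gt0 l i : (0 < nth 0 l i) = (i < size l).
Proof.
case: l => s /= /andP[_ s0]; case: (ltnP i (size s)) => [lt_i|le_i].
  by rewrite lt0n; apply: contra s0 => /eqP <-; rewrite mem_nth.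
by rewrite nth_default.
Qed.

Lemma part_anti l i j : i <= j -> nth 0 l j <= nth 0 l i.
Proof.
case: (ltnP j (size l)) => [lt_j le_ij|le_j _]; last by rewrite nth_default.
case: l lt_j => s /= /andP[s_sorted _] lt_j.
apply: (sorted_leq_nth (leT := geq)) => //.
- by move=> x y z /= yx xz; apply: leq_trans xz yx.
- by move=> x /=.
- by rewrite inE (leq_ltn_trans le_ij).
Qed.

Lemma le_size_part l m : (forall i, nth 0 l i <= nth 0 m i) -> size l <= size m.
Proof.
move=> le_lm; rewrite leqNgt; apply/negP => lt_ml.
have := le_lm (size m); rewrite [nth 0 m _]nth_default // leqNgt.
by rewrite part_gt0 lt_ml.
Qed.

Lemma intpart_eq l m : (forall i, nth 0 l i = nth 0 m i) -> l = m.
Proof.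
move=> eq_lm; apply/val_inj/(@eq_from_nth _ 0) => // /=.
by apply/eqP; rewrite eqn_leq !le_size_part // => i; rewrite eq_lm.
Qed.

(* Young's lattice: inclusion of Young diagrams. *)
Definition young_le l m := [forall i : 'I_(size l), nth 0 l i <= nth 0 m i].

Lemma young_leP l m :
  reflect (forall i, nth 0 l i <= nth 0 m i) (young_le l m).
Proof.
apply: (iffP forallP) => [le_lm i|le_lm i]; last exact: le_lm.
case: (ltnP i (size l)) => [lt_i|le_i]; last by rewrite nth_default.
exact: (le_lm (Ordinal lt_i)).
Qed.

Lemma young_le_refl : reflexive young_le.
Proof. by move=> l; apply/young_leP. Qed.

Lemma young_le_anti : antisymmetric young_le.
Proof.
move=> l m /andP[/young_leP le_lm /young_leP le_ml].
by apply: intpart_eq => i; apply/eqP; rewrite eqn_leq le_lm le_ml.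
Qed.

Lemma young_le_trans : transitive young_le.
Proof.
move=> m l n /young_leP le_lm /young_leP le_mn.
by apply/young_leP => i; apply: leq_trans (le_lm i) (le_mn i).
Qed.

Fact young_display : Order.disp_t. Proof. exact: Order.Disp tt tt. Qed.

HB.instance Definition _ := Order.Le_isPOrder.Build young_display intpart
  young_le_refl young_le_anti young_le_trans.

Definition empty_part : intpart := @IntPart [::] isT.

(* [incr_nth l i] lengthens row [i] by one box; [i = size l] starts a new *)
(* row. *)
Definition young_cover l m : bool :=
  [exists i : 'I_(size l).+1, parts m == incr_nth l i].

Definition added_row l m : nat :=
  find (fun i => nth 0 l i < nth 0 m i) (iota 0 (size m)).

Lemma added_rowE l m i : parts m = incr_nth l i -> added_row l m = i.
Proof.
move=> def_m; have nth_m j : nth 0 m j = (i == j) + nth 0 l j.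
  by rewrite def_m nth_incr_nth.
have lt_i : i < size m by rewrite -(part_gt0 m i) nth_m eqxx.
rewrite /added_row (_ : find _ _ = find (pred1 i) (iota 0 (size m))).
  rewrite -[find _ _]/(index i _) -[i in index i _](nth_iota 0 0 lt_i).
  by rewrite index_uniq ?size_iota ?iota_uniq.
apply: eq_find => j /=; rewrite nth_m eq_sym.
by case: eqP => _; rewrite ?add0n ?add1n ?ltnn ?ltnSn.
Qed.

Lemma young_coverP l m :
  young_cover l m <-> (l < m)%O /\ forall n, ~~ ((l < n)%O && (n < m)%O).
Proof.
have leP (x y : intpart) :
    (x <= y)%O -> forall i, nth 0 x i <= nth 0 y i by move/young_leP.
split=> [/existsP[i /eqP def_m]|[lt_lm no_n]].
  have nth_m j : nth 0 m j = ((i : nat) == j) + nth 0 l j.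
    by rewrite def_m nth_incr_nth.
  have le_lm : (l <= m)%O by apply/young_leP => j; rewrite nth_m leq_addl.
  split=> [|n].
    rewrite lt_neqAle le_lm andbT; apply/eqP => eq_lm.
    by have := nth_m i; rewrite -eq_lm eqxx add1n => /n_Sn.
  apply/andP => -[]; rewrite !lt_neqAle.
  case/andP=> /eqP ne_ln le_ln /andP[/eqP ne_nm le_nm].
  have le_i := leP _ _ le_nm i; rewrite nth_m eqxx add1n in le_i.
  have eq_j j : (i : nat) != j -> nth 0 n j = nth 0 l j.
    move=> /negPf ne_ij; apply/eqP; rewrite eqn_leq (leP _ _ le_ln) andbT.
    by have := leP _ _ le_nm j; rewrite nth_m ne_ij.
  move: le_i; rewrite leq_eqVlt => /orP[/eqP eq_i|lt_i].
    apply: ne_nm; apply: intpart_eq => j; rewrite nth_m.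
    by case: (eqVneq (i : nat) j) => [<-|/eq_j //]; rewrite eq_i.
  apply: ne_ln; apply: intpart_eq => j.
  case: (eqVneq (i : nat) j) => [<-|/eq_j //].
  by apply/eqP; rewrite eqn_leq (leP _ _ le_ln) -ltnS.
have le_lm := ltW lt_lm.
have [k lt_k] : exists k, nth 0 l k < nth 0 m k.
  have: ~~ (m <= l)%O by rewrite lt_geF.
  by case/forallPn=> k; rewrite -ltnNge; exists k.
case: (@ex_minnP (fun j => nth 0 l j < nth 0 m j)) => [|i lt_i min_i].
  by exists k.
have eq_before j : j < i -> nth 0 l j = nth 0 m j.
  move=> lt_ji; apply/eqP; rewrite eqn_leq (leP _ _ le_lm) leqNgt.
  by apply/negP => /min_i; rewrite leqNgt lt_ji.
have le_i : i <= size l.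
  rewrite leqNgt; apply/negP => lt_li.
  have: 0 < nth 0 m (size l).
    by rewrite (leq_trans _ (part_anti m (ltnW lt_li))) // (leq_ltn_trans _ lt_i).
  by rewrite -(eq_before _ lt_li) part_gt0 ltnn.
have part_n : sorted geq (incr_nth l i) && (0 \notin incr_nth l i).
  apply/andP; split.
    apply/(sortedP 0) => j; rewrite size_incr_nth !nth_incr_nth => lt_j /=.
    case: (eqVneq i j.+1) => [eq_i|ne_i].
      have lt_ji : j < i by rewrite eq_i.
      rewrite -eq_i gtn_eqF // add0n add1n (eq_before j lt_ji).
      by rewrite (leq_trans lt_i) // part_anti // ltnW.
    by rewrite (leq_trans (part_anti l (leqnSn j))) // leq_addl.
  apply/(nthP 0) => -[j]; rewrite size_incr_nth nth_incr_nth.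
  case: (eqVneq i j) => [//|ne_ij]; rewrite add0n => lt_j eq0.
  suff: j < size l by rewrite -(part_gt0 l j) eq0.
  move: lt_j; case: (ltnP i (size l)) => // le_li.
  rewrite ltnS leq_eqVlt eq_sym (negPf ne_ij) => lt_ji.
  exact: leq_trans lt_ji le_i.
pose n := IntPart part_n.
have nth_n j : nth 0 n j = (i == j) + nth 0 l j by rewrite nth_incr_nth.
have lt_ln : (l < n)%O.
  rewrite lt_neqAle; apply/andP; split.
    by apply/eqP => eq_ln; have := nth_n i; rewrite -eq_ln eqxx => /n_Sn.
  by apply/young_leP => j; rewrite nth_n leq_addl.
have le_nm : (n <= m)%O.
  apply/young_leP => j; rewrite nth_n.
  by case: (eqVneq i j) => [<- //|_]; apply: leP.
have /eqP <- : n == m.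
  by apply: contraNT (no_n n) => ne_nm; rewrite lt_ln lt_neqAle ne_nm.
by apply/existsP; exists (Ordinal (le_i : i < (size l).+1)) => /=.
Qed.

(* The interval below [l], a finite type: every chain from the empty *)
(* partition to [l] lives in it. *)
Record below l := Below { below_val :> intpart; _ : (below_val <= l)%O }.

HB.instance Definition _ l := [isSub for @below_val l].
HB.instance Definition _ l := [Countable of below l by <:].

Section BelowFinite.
Variable l : intpart.

Definition below_encode (x : below l) : {ffun 'I_(size l) -> 'I_(nth 0 l 0).+1}
  := [ffun i : 'I_(size l) => inord (nth 0 x i)].

Definition below_decode (f : {ffun 'I_(size l) -> 'I_(nth 0 l 0).+1}) :
    option (below l) :=
  obind (fun n : intpart => insub n)
    (insub [seq k <- [seq (f i : nat) | i <- enum 'I_(size l)] | 0 < k]).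

Lemma below_encodeK : pcancel below_encode below_decode.
Proof.
case=> x le_xl; have /young_leP le_x := le_xl.
have le_size : size x <= size l.
  exact: le_size_part.
rewrite /below_decode; set s := filter _ _.
have -> : s = x.
  rewrite /s (_ : map _ _ = mkseq (nth 0 x) (size l)); last first.
    rewrite /mkseq -val_enum_ord -map_comp; apply: eq_map => i /=.
    by rewrite ffunE inordK // ltnS (leq_trans (le_x i)) // part_anti.
  rewrite -(subnKC le_size) /mkseq iotaD map_cat filter_cat add0n.
  rewrite -/(mkseq _ _) mkseq_nth.
  have -> : [seq k <- x | 0 < k] = x.
    apply/all_filterP/allP => k k_x; rewrite lt0n.
    by case: (x) k_x => t /= /andP[_ t0] k_t; apply: contraNneq t0 => <-.
  rewrite (_ : filter _ _ = [::]) ?cats0 //.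
  apply/eqP; rewrite -(negbK (_ == _)) -has_filter; apply/hasPn => k.
  case/mapP=> i; rewrite mem_iota => /andP[le_i _] ->.
  by rewrite part_gt0 -leqNgt.
by rewrite valK /= insubT.
Qed.

End BelowFinite.

HB.instance Definition _ l : isFinite (below l) :=
  PCanIsFinite (@below_encodeK l).

Definition is_maxchain l (c : {ffun 'I_(sumn l).+1 -> below l}) : bool :=
  [&& c ord0 == empty_part :> intpart,
      c ord_max == l :> intpart &
      [forall i : 'I_(sumn l), young_cover (c (inord i)) (c (inord i.+1))]].

Local Open Scope ring_scope.

(* The 0-based odd rows are the even-numbered parts lambda_2, lambda_4, ... *)
Definition a_sign l : int := (-1) ^+ (\sum_(i < size l | odd i) nth 0 l i)%N.

Definition s_alpha l m : int :=
  (-1) ^+ (\sum_(j < (added_row l m).+1) nth 0 l j)%N.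

Definition s_beta l m : int := (a_sign l * a_sign m) * s_alpha l m.

Definition signed_chain_sum (s : intpart -> intpart -> int) l : int :=
  \sum_(c : {ffun 'I_(sumn l).+1 -> below l} | is_maxchain c)
    \prod_(i < sumn l) s (c (inord i)) (c (inord i.+1)).

Local Close Scope ring_scope.

(* A box is a row [tag b] together with a column [tagged b]. *)
Definition box l := {i : 'I_(size l) & 'I_(nth 0 l i)}.
HB.instance Definition _ l := Finite.on (box l).

(* Entries are 0, ..., |l| - 1 instead of 1, ..., |l|. An injective filling *)
(* uses each of them once, by [card_box] below. *)
Definition is_standard l (T : {ffun box l -> 'I_(sumn l)}) : bool :=
  [&& injectiveb T,
      [forall b : box l, forall b' : box l,
        (tag b == tag b') && (tagged b < tagged b') ==> (T b < T b')] &
      [forall b : box l, forall b' : box l,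
        (tag b < tag b') && (tagged b == tagged b' :> nat) ==> (T b < T b')]].

Record syt l := Syt {
  filling :> {ffun box l -> 'I_(sumn l)};
  _ : is_standard filling }.

HB.instance Definition _ l := [isSub for @filling l].
HB.instance Definition _ l := [Finite of syt l by <:].

Definition reading_order l : seq (box l) :=
  [seq Tagged (fun i : 'I_(size l) => 'I_(nth 0 l i)) j
     | i : 'I_(size l) <- rev (enum 'I_(size l)),
       j : 'I_(nth 0 l i) <- rev (enum 'I_(nth 0 l i))].

Lemma size_reading_order l : size (reading_order l) = sumn l.
Proof.
rewrite size_allpairs_dep -[in RHS](mkseq_nth 0 l) /mkseq -val_enum_ord.
rewrite map_rev sumn_rev -map_comp; congr sumn.
by apply: eq_map => i /=; rewrite size_rev size_enum_ord.
Qed.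

Lemma reading_order_uniq l : uniq (reading_order l).
Proof.
apply: allpairs_uniq_dep => [|i _|]; rewrite ?rev_uniq ?enum_uniq //.
by case=> i j [i' j'] _ _.
Qed.

Lemma mem_reading_order l b : b \in reading_order l.
Proof.
by case: b => i j; apply/allpairsPdep; exists i, j; rewrite !mem_rev !mem_enum.
Qed.

Lemma card_box l : #|{: box l}| = sumn l.
Proof.
rewrite -size_reading_order cardE; apply/perm_size/uniq_perm.
- exact: enum_uniq.
- exact: reading_order_uniq.
- by move=> b; rewrite mem_reading_order mem_enum.
Qed.

Lemma size_reading_word l (T : syt l) :
  size [seq T b | b <- reading_order l] == sumn l.
Proof. by rewrite size_map size_reading_order. Qed.

Definition reading_word l (T : syt l) : (sumn l).-tuple 'I_(sumn l) :=
  Tuple (size_reading_word T).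

Lemma reading_word_inj l (T : syt l) : injective (tnth (reading_word T)).
Proof.
apply/tuple_uniqP; rewrite map_inj_uniq ?reading_order_uniq //.
by case: T => T /= /and3P[/injectiveP].
Qed.

(* The reading word as one-line notation. *)
Definition reading_perm l (T : syt l) : 'S_(sumn l) :=
  perm (@reading_word_inj l T).

Local Open Scope ring_scope.

Definition tableau_sign l (T : syt l) : int := (-1) ^+ odd_perm (reading_perm T).

Definition sign_imbalance l : int := \sum_(T : syt l) tableau_sign T.

(* Main.v *)
Require Import Defs.
From mathcomp Require Import all_boot all_order all_algebra all_fingroup.

Set Implicit Arguments.
Unset Strict Implicit.
Unset Printing Implicit Defensive.

Import Order.TTheory GRing.Theory Num.Theory.

(** A standard tableau T of shape l is the same thing as a maximal chain from
    the empty partition to l: the k-th member of the chain is the set of boxes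
    whose entry is smaller than k, and T is recovered from the chain because a
    box has entry k exactly when it is added at step k. The relation between T
    and its chain c is [sublevels T c]; [sublevels_of_syt],
    [sublevels_inj], [sublevels_maxchain] and [maxchain_sublevels] make it a
    bijection, and [sum_maxchains] turns a sum over chains into a sum over
    tableaux.

    It remains to see that the weight of a chain is the sign of its tableau.
    The sign of the reading word is (-1) to the number of its inversions.
    Group the inversions by their larger entry: let that entry be k, sitting
    in box b in row i, and let x be the member of the chain just before b is
    added. The other entry of the inversion is smaller than k, so its box lies
    in x, and it is read after b. Rows are read from right to left and from
    the bottom up, and every box of x in row i is to the left of b; so the
    boxes of x read after b are exactly those in rows 1, ..., i. Their number
    x_1 + ... + x_i is the exponent in s_alpha for the step adding b
    ([count_read_after]). Taking the product over k gives
    [tableau_sign_sublevels], hence the identity for alpha.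

    For beta, the additional factors a(x) a(y) along a chain telescope to
    a(empty) a(l) = a(l), which is the same for every chain ([beta_chain]). *)

Implicit Types l : intpart.

(** * Boxes and order ideals of a diagram *)

Definition in_shape l (x : intpart) (b : box l) : bool := tagged b < nth 0 x (tag b).

Lemma ltn_ext a b : (forall j, (j < a) = (j < b)) -> a = b.
Proof.
by move=> eq_ab; apply/eqP; rewrite eqn_leq leqNgt eq_ab ltnn leqNgt -eq_ab ltnn.
Qed.

Lemma box_at l i j : j < nth 0 l i ->
  exists b : box l, [/\ tag b = i :> nat, tagged b = j :> nat &
    forall x, in_shape x b = (j < nth 0 x i)].
Proof.
move=> lt_j; have lt_i : i < size l by rewrite -Defs.part_gt0 (leq_ltn_trans _ lt_j).
by exists (Tagged (fun i : 'I_(size l) => 'I_(nth 0 l i))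
             (Ordinal (lt_j : j < nth 0 l (Ordinal lt_i)))).
Qed.

Lemma box_eqP l (b b' : box l) :
  tag b = tag b' :> nat -> tagged b = tagged b' :> nat -> b = b'.
Proof.
case: b b' => [i j] [i' j'] /= /val_inj eq_i; subst i'.
by move/val_inj => ->.
Qed.

Lemma below_le l (x : below l) i : nth 0 x i <= nth 0 l i.
Proof. by case: x => x /= /young_leP. Qed.

Lemma in_shape_inj l (x y : below l) :
  (forall b : box l, in_shape x b = in_shape y b) -> x = y.
Proof.
move=> eq_xy; apply/val_inj/intpart_eq => i /=; apply: ltn_ext => j.
case: (ltnP j (nth 0 l i)) => [/box_at[b [_ _ bE]]|le_j].
  by rewrite -!bE.
by rewrite !ltnNge !(leq_trans (below_le _ i)).
Qed.

(** The parts are the values before the first zero; all later values vanish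
    because f decreases. *)
Lemma intpart_of_fun (f : nat -> nat) N :
  (forall i j, i <= j -> f j <= f i) -> f N = 0 ->
  {x : intpart | forall i, nth 0 x i = f i}.
Proof.
move=> anti fN0; have ex0 : exists n, f n == 0 by exists N; rewrite fN0.
case: (ex_minnP ex0) => m /eqP fm0 min_m.
have part_s : sorted geq (mkseq f m) && (0 \notin mkseq f m).
  apply/andP; split.
    apply/(sortedP 0) => i; rewrite size_mkseq => lt_i.
    by rewrite !nth_mkseq ?(ltnW lt_i) //= anti.
  apply/mapP => -[i]; rewrite mem_iota /= => lt_i f0.
  by have := min_m i; rewrite -f0 => /(_ isT); rewrite leqNgt lt_i.
exists (IntPart part_s) => i /=; case: (ltnP i m) => [lt_i|le_i].
  by rewrite nth_mkseq.
rewrite nth_default ?size_mkseq //.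
by have := anti _ _ le_i; rewrite fm0 leqn0 => /eqP.
Qed.

Definition order_ideal l (P : pred (box l)) : Prop :=
  forall b b' : box l, tag b <= tag b' -> tagged b <= tagged b' -> P b' -> P b.

Lemma count_prefix n (p : pred nat) :
  (forall j j', j <= j' < n -> p j' -> p j) ->
  forall j, j < n -> (j < count p (iota 0 n)) = p j.
Proof.
elim: n => // n IHn down j lt_j.
rewrite -[n.+1]addn1 iotaD count_cat /= add0n addn0.
have le_n : count p (iota 0 n) <= n by rewrite -[X in _ <= X](size_iota 0) count_size.
case pn : (p n).
  have all_p : forall i, i < n -> p i.
    by move=> i lt_i; apply: (down i n); rewrite // (ltnW lt_i) /=.
  have -> : count p (iota 0 n) = n.
    by rewrite -[RHS](size_iota 0); apply/eqP; rewrite -all_count;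
       apply/allP => i; rewrite mem_iota /= => /all_p.
  rewrite /= addn1 lt_j; apply/esym; move: lt_j.
  by rewrite ltnS leq_eqVlt => /orP[/eqP ->|/all_p].
rewrite addn0; move: lt_j; rewrite ltnS leq_eqVlt => /orP[/eqP->|].
  by rewrite pn ltnNge le_n.
apply: IHn => i i' /andP[le_i lt_i']; apply: down; by rewrite le_i ltnS ltnW.
Qed.

(** Row by row, an order ideal is an initial segment, so counting its boxes in
    each row gives the parts of a partition; the parts decrease because the
    ideal is also closed upwards along columns. *)
Lemma below_of_ideal l (P : pred (box l)) : order_ideal P ->
  {x : below l | forall b, in_shape x b = P b}.
Proof.
move=> downP.
pose p i j := [exists b : box l, [&& tag b == i :> nat, tagged b == j :> nat & P b]].
have pE (b : box l) : p (tag b) (tagged b) = P b.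
  apply/existsP/idP => [[b' /and3P[/eqP e1 /eqP e2]]|Pb]; last by exists b; rewrite !eqxx.
  by apply: downP; rewrite ?e1 ?e2.
have p_down i i' j j' : i <= i' -> j <= j' -> p i' j' -> p i j.
  move=> le_i le_j /existsP[[r s] /and3P[/= /eqP e1 /eqP e2 Pb]].
  have [|b [e1' e2' _]] := @box_at l i j.
    rewrite (leq_ltn_trans le_j) // -e2 (leq_trans (ltn_ord s)) //=.
    by rewrite part_anti // e1.
  apply/existsP; exists b; apply/and3P; split; [exact/eqP | exact/eqP |].
  by apply: downP Pb; [rewrite e1' e1 | rewrite e2' e2].
pose f i := count (p i) (iota 0 (nth 0 l i)).
have [i j le_ij||x nth_x] := @intpart_of_fun f (size l).
- rewrite /f -(subnKC (part_anti l le_ij)) iotaD count_cat.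
  by apply: leq_trans (leq_addr _ _); apply: sub_count => k; apply: p_down.
- by rewrite /f nth_default.
have le_xl : (x <= l)%O.
  apply/young_leP => i; rewrite nth_x /f -[X in _ <= X](size_iota 0).
  exact: count_size.
exists (Below le_xl) => b; rewrite /in_shape /= nth_x /f count_prefix ?pE //.
by move=> j j' /andP[le_j _]; apply: p_down.
Qed.

(** Membership of boxes determines the parts, so adjoining one box to a
    diagram is the same as a cover of Young's lattice, and the row of the box
    is the row on which s_alpha depends. *)
Lemma added_box l (x y : below l) (b0 : box l) :
  ~~ in_shape x b0 -> (forall b, in_shape y b = (b == b0) || in_shape x b) ->
  young_cover x y /\ added_row x y = tag b0.
Proof.
move=> xb0 yE.
have y_b0 : tagged b0 < nth 0 y (tag b0) by have := yE b0; rewrite eqxx.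
(* A gap between the end of row [tag b0] of x and b0 would be filled in y by a
   second new box. *)
have x_b0 : nth 0 x (tag b0) = tagged b0.
  apply/eqP; rewrite eqn_leq leqNgt xb0 leqNgt; apply/negP => lt_x.
  have [b [e1 e2 bE]] := box_at (ltn_trans lt_x (ltn_ord (tagged b0))).
  have := yE b; rewrite !bE ltnn orbF (ltn_trans lt_x) //.
  by move/esym/eqP => eb; rewrite eb in e2; rewrite -e2 ltnn in lt_x.
have nth_y i : nth 0 y i = ((tag b0 : nat) == i) + nth 0 x i.
  apply: ltn_ext => j; case: (ltnP j (nth 0 l i)) => [/box_at[b [<- <- _]]|le_j].
    have := yE b; rewrite /in_shape => ->.
    have [eq_t|ne_t] := eqVneq (tag b0 : nat) (tag b).
      have -> : nth 0 x (tag b) = tagged b0 by rewrite -eq_t.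
      rewrite add1n ltnS [in RHS]leq_eqVlt; congr (_ || _).
      apply/eqP/eqP => [-> //|e2]; exact: box_eqP.
    by case: eqP => // eb; rewrite eb eqxx in ne_t.
  rewrite !ltnNge (leq_trans (below_le y i)) //; congr (~~ _); apply/esym.
  case: eqP le_j => [<- le_j|_]; last exact: leq_trans (below_le x i).
  by rewrite x_b0 add1n; apply: leq_trans (ltn_ord _) le_j.
have le_size : tag b0 <= size x.
  rewrite leqNgt; apply/negP => lt_x.
  have := part_anti y (ltnW lt_x); rewrite !nth_y eqxx.
  by rewrite [nth 0 x (size x)]nth_default // gtn_eqF.
have def_y : parts y = incr_nth x (tag b0).
  have size_y : size y = size (incr_nth x (tag b0)).
    apply: ltn_ext => i; rewrite -Defs.part_gt0 nth_y size_incr_nth.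
    rewrite addn_gt0 Defs.part_gt0 lt0b.
    case: (ltnP (tag b0) (size x)) => [lt_b|le_b].
      by case: eqP => [<-|_]; rewrite ?lt_b.
    have -> : size x = tag b0 by apply/eqP; rewrite eqn_leq le_b le_size.
    by rewrite ltnS [in RHS]leq_eqVlt eq_sym.
  by apply: (@eq_from_nth _ 0 _ _ size_y) => i _; rewrite nth_incr_nth nth_y.
split; last exact: added_rowE def_y.
by apply/existsP; exists (Ordinal (le_size : tag b0 < (size x).+1)); rewrite def_y.
Qed.

Lemma added_boxP l (x y : below l) : young_cover x y ->
  exists2 b0 : box l, ~~ in_shape x b0 &
    forall b, in_shape y b = (b == b0) || in_shape x b.
Proof.
case/existsP => i /eqP def_y.
have nth_y j : nth 0 y j = ((i : nat) == j) + nth 0 x j by rewrite def_y nth_incr_nth.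
have [|b0 [e1 e2 b0E]] := @box_at l i (nth 0 x i).
  by rewrite (leq_trans _ (below_le y i)) // nth_y eqxx.
exists b0; rewrite ?b0E ?ltnn // => b; rewrite /in_shape.
rewrite nth_y; have [eq_t|ne_t] := eqVneq (i : nat) (tag b).
  have -> : nth 0 x (tag b) = tagged b0 by rewrite e2 eq_t.
  rewrite add1n ltnS (leq_eqVlt (tagged b)); congr (_ || _).
  apply/eqP/eqP => [e|-> //]; apply: box_eqP => //; by rewrite e1.
by case: eqP => // eb; rewrite -e1 eb eqxx in ne_t.
Qed.

(** * The sign of a tableau counts inversions between boxes *)

(** Permuting the nodes 0, ..., n-1 of a Vandermonde determinant by s
    multiplies it by the sign of s. By the product formula the determinant is
    positive for the identity, and its sign for s is the product over i < j of
    the signs of s j - s i. *)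
Lemma sign_perm_inversions n (s : 'S_n) :
  ((-1) ^+ s = \prod_(i < n) \prod_(j < n | (i < j)%N) (-1) ^+ (s j < s i)%N :> int)%R.
Proof.
pose a (t : 'S_n) : 'rV[int]_n := (\row_i (t i)%:Z)%R.
have sgz_prod (I : finType) (P : pred I) (F : I -> int) :
    sgz (\prod_(i | P i) F i)%R = (\prod_(i | P i) sgz (F i))%R.
  exact: (big_morph _ (@sgzM _) (@sgz1 _)).
have sgz_det (t : 'S_n) : (sgz (\det (Vandermonde n (a t))) =
    \prod_(i < n) \prod_(j < n | (i < j)%N) (-1) ^+ (t j < t i)%N)%R.
  rewrite det_Vandermonde sgz_prod; apply: eq_bigr => i _.
  rewrite sgz_prod; apply: eq_bigr => j lt_ij.
  rewrite !mxE sgz_def subr_eq0 subr_lt0 ltz_nat eqz_nat.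
  by rewrite (inj_eq val_inj) (inj_eq perm_inj) -[j == i]val_eqE /= gtn_eqF.
have V_s : Vandermonde n (a s) = col_perm s (Vandermonde n (a 1%g)).
  by apply/matrixP => i j; rewrite !mxE perm1.
rewrite -sgz_det V_s col_permE det_mulmx det_perm odd_permV sgzM sgz_det.
rewrite big1 ?mul1r => [|i _]; last first.
  by rewrite big1 // => j lt_ij; rewrite !perm1 ltnNge ltnW.
by case: (odd_perm s).
Qed.

(** The order in which the reading word visits the boxes: lower rows first,
    and right to left inside a row. *)
Definition reads_before l (b b' : box l) : bool :=
  (tag b' < tag b) || (tag b' == tag b :> nat) && (tagged b' < tagged b).

Lemma pairwise_tagged (I : eqType) (J : I -> eqType) (e : rel I)
    (r : rel {i : I & J i}) (s : seq I) (t : forall i, seq (J i)) :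
  (forall i i' (j : J i) (j' : J i'), e i i' -> r (Tagged J j) (Tagged J j')) ->
  (forall i, pairwise (relpre (fun j : J i => Tagged J j) r) (t i)) ->
  pairwise e s -> pairwise r [seq Tagged J j | i <- s, j <- t i].
Proof.
move=> lt_r t_r; elim: s => //= i s IHs /andP[/allP e_i /IHs s_r].
rewrite pairwise_cat s_r pairwise_map t_r !andbT; apply/allrelP => x y.
by case/mapP=> j _ -> /allpairsPdep[i' [j' [/e_i e_ii' _ ->]]]; apply: lt_r.
Qed.

Lemma pairwise_rev_enum n :
  pairwise (fun i j : 'I_n => j < i) (rev (enum 'I_n)).
Proof.
rewrite -sorted_pairwise => [|j i k /= lt_ji lt_kj]; last exact: ltn_trans lt_ji.
by have := iota_ltn_sorted 0 n; rewrite -val_enum_ord rev_sorted sorted_map.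
Qed.

Lemma pairwise_reading_order l : pairwise (@reads_before l) (reading_order l).
Proof.
apply: (pairwise_tagged _ _ (pairwise_rev_enum _)) => [i i' j j' lt_i|i].
  by rewrite /reads_before /= lt_i.
apply: sub_pairwise (pairwise_rev_enum _) => j j' lt_j.
by rewrite /reads_before /= eqxx lt_j orbT.
Qed.

(** Indexing the inversions of the reading word by boxes instead of positions
    allows them to be grouped later by the entry T b. *)
Lemma tableau_sign_boxes l (T : syt l) :
  (tableau_sign T = \prod_b \prod_(b' | reads_before b b') (-1) ^+ (T b' < T b)%N)%R.
Proof.
have size_R : size (reading_order l) == sumn l by rewrite size_reading_order.
pose R := tnth (Tuple size_R).
have bijR : bijective R.
  apply: inj_card_bij; last by rewrite card_box card_ord.
  apply/tuple_uniqP; exact: reading_order_uniq.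
(* The reading order is listed without repetition and increasing for
   [reads_before], which is asymmetric, so positions compare as boxes do. *)
have RE p q : reads_before (R p) (R q) = (p < q).
  have before (p' q' : 'I_(sumn l)) : p' < q' -> reads_before (R p') (R q').
    move=> lt_pq; have b0 := R p'; rewrite /R !(tnth_nth b0) /=.
    have /(pairwiseP b0) := pairwise_reading_order l.
    by apply; rewrite // inE size_reading_order.
  case: (ltngtP p q) => [/before // | /before | /val_inj ->].
    rewrite /reads_before; case: ltngtP => //= _; case: ltngtP => //=.
  by rewrite /reads_before !ltnn andbF.
have permE' p : reading_perm T p = T (R p).
  rewrite permE /R (tnth_nth (T (R p))) (tnth_nth (R p)) /=.
  by rewrite (nth_map (R p)) ?size_reading_order.
rewrite /tableau_sign sign_perm_inversions (reindex R) /=; last exact: onW_bij.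
apply: eq_bigr => p _; rewrite [RHS](reindex R) /=; last exact: onW_bij.
by apply: eq_big => q; rewrite ?RE // !permE'.
Qed.

(** * Standard tableaux and maximal chains *)

(** The form of standardness that matches order ideals: the sets of boxes with
    entries below k are closed towards the top left corner. For two boxes in
    general position the comparison goes through the box in the row of the
    first and the column of the second; strictness along rows and columns is
    recovered from injectivity. *)
Lemma standardP l (T : {ffun box l -> 'I_(sumn l)}) :
  is_standard T <-> injective T /\
    forall b b' : box l, tag b <= tag b' -> tagged b <= tagged b' -> T b <= T b'.
Proof.
have lt_le (b b' : box l) : b <> b' -> injective T -> (T b < T b') = (T b <= T b').
  by move=> ne_b injT; rewrite [RHS]leq_eqVlt; case: eqP => // /val_inj/injT.
split=> [/and3P[/injectiveP injT /'forall_forallP row_lt /'forall_forallP col_lt]|].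
  split=> // b b' le_i le_j.
  have [|m [e1 e2 _]] := @box_at l (tag b) (tagged b').
    by apply: leq_trans (ltn_ord _) _; apply: part_anti.
  apply: (@leq_trans (T m)).
    move: le_j; rewrite leq_eqVlt => /orP[/eqP e|lt_j].
      by rewrite (@box_eqP _ b m) // e2.
    apply: ltnW; apply: (implyP (row_lt b m)).
    by apply/andP; split; [apply/eqP/val_inj | rewrite e2].
  move: le_i; rewrite leq_eqVlt => /orP[/eqP e|lt_i].
    by rewrite (@box_eqP _ m b') // e1.
  apply: ltnW; apply: (implyP (col_lt m b')).
  by apply/andP; split; [rewrite e1 | exact/eqP].
case=> injT mono; apply/and3P; split; first exact/injectiveP.
  apply/'forall_forallP => b b'; apply/implyP => /andP[/eqP e lt_j].
  rewrite lt_le // => [|eb]; last by rewrite eb ltnn in lt_j.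
  by apply: mono; [rewrite e | exact: ltnW].
apply/'forall_forallP => b b'; apply/implyP => /andP[lt_i /eqP e].
rewrite lt_le // => [|eb]; last by rewrite eb ltnn in lt_i.
by apply: mono; [exact: ltnW | rewrite e].
Qed.

(** A relation rather than a function, so that the passages from tableaux to
    chains and from chains to tableaux are two existence statements about it,
    and neither inverse has to be computed. *)
Definition sublevels l (T : syt l)
    (c : {ffun 'I_(sumn l).+1 -> below l}) : Prop :=
  forall (k : 'I_(sumn l).+1) (b : box l), in_shape (c k) b = (T b < k).

Lemma sublevels_of_syt l (T : syt l) : {c | sublevels T c}.
Proof.
have shape (k : 'I_(sumn l).+1) :
    {x : below l | forall b, in_shape x b = (T b < k)}.
  apply: below_of_ideal => b b' le_i le_j; apply: leq_ltn_trans.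
  by have /standardP[_] := valP T; apply.
by exists [ffun k => sval (shape k)] => k b; rewrite ffunE; case: (shape k).
Qed.

Lemma sublevels_inj l (T T' : syt l) c : sublevels T c -> sublevels T' c -> T = T'.
Proof.
have le_sub (U U' : syt l) b : sublevels U c -> sublevels U' c -> U b <= U' b.
  move=> Uc U'c; pose k : 'I_(sumn l).+1 := inord (U' b).+1.
  have kE : k = (U' b).+1 :> nat by rewrite inordK // ltnS.
  by rewrite -ltnS -kE -Uc U'c kE.
move=> Tc T'c; apply/val_inj/ffunP => b; apply/val_inj/eqP.
by rewrite /= eqn_leq !le_sub.
Qed.

Lemma standard_bij l (T : syt l) : bijective T.
Proof.
apply: inj_card_bij; last by rewrite card_box card_ord.
by have /standardP[] := valP T.
Qed.

(** At step T b the chain gains the box b and nothing else, since T takes the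
    value T b only there. *)
Lemma sublevels_step l (T : syt l) c b : sublevels T c ->
  let x := c (inord (T b)) in let y := c (inord (T b).+1) in
  ~~ in_shape x b /\ forall b', in_shape y b' = (b' == b) || in_shape x b'.
Proof.
move=> Tc x y; rewrite /x /y.
have lt_T := ltn_ord (T b).
split=> [|b']; rewrite !Tc !inordK ?ltnS ?ltnn ?(ltnW lt_T) //.
by rewrite leq_eqVlt val_eqE (bij_eq (standard_bij T)).
Qed.

Lemma sublevels_maxchain l (T : syt l) c : sublevels T c -> is_maxchain c.
Proof.
move=> Tc; apply/and3P; split.
- have le0 : (empty_part <= l)%O by apply/young_leP => i; rewrite nth_nil.
  rewrite (_ : c ord0 = Below le0) //; apply: in_shape_inj => b.
  by rewrite Tc /in_shape /= nth_nil.
- rewrite (_ : c ord_max = Below (lexx l)) //; apply: in_shape_inj => b.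
  by rewrite Tc /in_shape /= !ltn_ord.
apply/forallP => k; have [t _ tK] := standard_bij T.
have [xb yE] := sublevels_step (t k) Tc.
by have [+ _] := added_box xb yE; rewrite tK.
Qed.

Lemma inord_ord0 n : inord 0 = ord0 :> 'I_n.+1.
Proof. by apply/val_inj; rewrite /= inordK. Qed.

Lemma inord_ord_max n : inord n = ord_max :> 'I_n.+1.
Proof. by apply/val_inj; rewrite /= inordK. Qed.

(** The entry of a box is the step at which the chain acquires it. Each step
    adds only one box, so the entries are distinct; every member of the chain
    is closed towards the top left corner, so the entries are monotone. *)
Lemma maxchain_sublevels l (c : {ffun 'I_(sumn l).+1 -> below l}) :
  is_maxchain c -> exists T : syt l, sublevels T c.
Proof.
case/and3P=> /eqP c0 /eqP cn /forallP c_cover.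
pose D k (b : box l) := in_shape (c (inord k)) b.
have D0 b : D 0 b = false.
  by rewrite /D inord_ord0 /in_shape c0 nth_nil.
have Dn b : D (sumn l) b.
  by rewrite /D inord_ord_max /in_shape cn ltn_ord.
have D_step k : k < sumn l ->
    exists2 b0 : box l, ~~ D k b0 & forall b, D k.+1 b = (b == b0) || D k b.
  by move=> lt_k; have := added_boxP (c_cover (Ordinal lt_k)).
have D_mono k k' b : k <= k' -> k' <= sumn l -> D k b -> D k' b.
  elim: k' => [|k' IH]; first by rewrite leqn0 => /eqP->.
  rewrite leq_eqVlt => /orP[/eqP-> //|le_k] lt_k' Dk.
  by have [b0 _ ->] := D_step _ lt_k'; rewrite IH ?orbT // ltnW.
have time b : {t : 'I_(sumn l) | forall k, k <= sumn l -> D k b = (t < k)}.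
  have exD : exists k, D k b by exists (sumn l).
  case: (ex_minnP exD) => [[|t]]; first by rewrite D0.
  move=> Dt min_t; have lt_t : t < sumn l := min_t _ (Dn b).
  exists (Ordinal lt_t) => k le_k; apply/idP/idP => [/min_t //|/= lt_tk].
  exact: D_mono Dt.
pose T := [ffun b => sval (time b)].
have TE b k : k <= sumn l -> D k b = (T b < k).
  by rewrite ffunE; case: (time b) => t /=; apply.
have std_T : is_standard T.
  apply/standardP; split=> [b b' eq_T|b b' le_i le_j].
    have [b0 _ b0E] := D_step _ (ltn_ord (T b)).
    have new b1 : T b1 = T b -> b1 = b0.
      move=> e; have := b0E b1; rewrite !TE ?e ?ltnn ?ltnSn // ?(ltnW (ltn_ord _)) //.
      by rewrite orbF => /esym/eqP.
    exact: etrans (new b erefl) (esym (new b' (esym eq_T))).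
  rewrite -ltnS -TE //; have := ltnSn (T b'); rewrite -TE // /D /in_shape => lt_j.
  by apply: leq_trans (part_anti _ le_i); apply: leq_ltn_trans lt_j.
exists (Syt std_T) => k b /=; rewrite -TE ?/D ?inord_val //.
by rewrite -ltnS.
Qed.

Lemma sum_ltn n a : a <= n -> \sum_(j < n) (j < a) = a.
Proof.
move=> le_an; rewrite -big_mkcond /= (big_ord_narrow le_an) /=.
by rewrite sum1_card card_ord.
Qed.

(** In the row of b, no box of x is read before b, because b itself
    is outside x and x is an initial segment of that row. Hence the boxes of x
    read after b are all its boxes in the rows down to that of b. *)
Lemma count_read_after l (x : below l) (b : box l) : ~~ in_shape x b ->
  \sum_(b' : box l | reads_before b b') (in_shape x b' : nat) =
  \sum_(i < (tag b).+1) nth 0 x i.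
Proof.
rewrite /in_shape -leqNgt => le_b.
transitivity (\sum_(b' : box l | tag b' <= tag b) in_shape x b').
  rewrite big_mkcond [RHS]big_mkcond /=; apply: eq_bigr => b' _.
  rewrite /reads_before; case: (ltngtP (tag b') (tag b)) => //= e.
  case: ltnP => // le_j; rewrite /in_shape ltnNge (leq_trans _ le_j) //.
  by rewrite e.
transitivity (\sum_(b' : box l | (tag b' <= tag b) && true)
    (tagged b' < nth 0 x (tag b') : nat)).
  by apply: eq_bigl => b'; rewrite andbT.
rewrite -(@sig_big_dep _ _ _ 'I_(size l) (fun i : 'I_(size l) => 'I_(nth 0 l i))
  (fun i => i <= tag b) (fun _ _ => true) (fun i j => (j < nth 0 x i) : nat)) /=.
under eq_bigr => i _ do rewrite sum_ltn ?below_le //.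
by rewrite (big_ord_narrow (ltn_ord (tag b))).
Qed.

Local Open Scope ring_scope.

(** The inversions whose larger entry lies in b contribute the same power of -1
    to the sign of T as the step adding b does to the weight of the chain. *)
Lemma tableau_sign_sublevels l (T : syt l) c : sublevels T c ->
  \prod_(i < sumn l) s_alpha (c (inord i)) (c (inord i.+1)) = tableau_sign T.
Proof.
move=> Tc; rewrite tableau_sign_boxes (reindex T) /=; last first.
  exact/onW_bij/standard_bij.
apply: eq_bigr => b _; have [xb yE] := sublevels_step b Tc.
have [_ row_b] := added_box xb yE.
rewrite /s_alpha row_b -(count_read_after xb) prodrXr; congr (_ ^+ _).
by apply: eq_bigr => b' _; rewrite Tc inordK // ltnW // ltnS.
Qed.

Lemma sum_maxchains l (F : {ffun 'I_(sumn l).+1 -> below l} -> int) (G : syt l -> int) :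
  (forall (T : syt l) c, sublevels T c -> F c = G T) ->
  \sum_(c | is_maxchain c) F c = \sum_T G T.
Proof.
move=> FG; pose h (T : syt l) := sval (sublevels_of_syt T : {c | sublevels T c}).
have hP T : sublevels T (h T) by apply: (svalP (sublevels_of_syt T)).
have inj_h : injective h.
  by move=> T T' eq_h; apply: (@sublevels_inj _ _ _ (h T)); rewrite // eq_h.
rewrite (eq_bigl (mem [set h T | T in predT])) => [|c]; last first.
  apply/idP/imsetP => [/maxchain_sublevels[T Tc]|[T _ ->]]; last first.
    exact: sublevels_maxchain (hP T).
  exists T => //; apply/ffunP => k; apply: in_shape_inj => b.
  by rewrite Tc hP.
rewrite big_imset => [|T T' _ _]; last exact: inj_h.
by apply: eq_bigr => T _; apply: FG.
Qed.

(** Every interior value occurs twice, and its square is 1. *)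
Lemma telescope_sign n (u : nat -> int) : (forall k, u k * u k = 1) ->
  \prod_(k < n) (u k * u k.+1) = u 0%N * u n.
Proof.
move=> u2; elim: n => [|n IHn]; first by rewrite big_ord0 u2.
by rewrite big_ord_recr /= IHn mulrA -(mulrA (u 0%N)) u2 mulr1.
Qed.

Lemma beta_chain l (c : {ffun 'I_(sumn l).+1 -> below l}) : is_maxchain c ->
  \prod_(i < sumn l) s_beta (c (inord i)) (c (inord i.+1)) =
  a_sign l * \prod_(i < sumn l) s_alpha (c (inord i)) (c (inord i.+1)).
Proof.
case/and3P=> /eqP c0 /eqP cn _; rewrite big_split /=; congr (_ * _).
rewrite (@telescope_sign _ (fun k => a_sign (c (inord k)))) => [|k]; last first.
  by rewrite -expr2 sqrr_sign.
by rewrite inord_ord0 inord_ord_max c0 cn [a_sign empty_part]/a_sign big_ord0 mul1r.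
Qed.

Theorem proposition5p3 (l : intpart) :
  signed_chain_sum s_alpha l = sign_imbalance l /\
  signed_chain_sum s_beta l = a_sign l * sign_imbalance l.
Proof.
have alpha : signed_chain_sum s_alpha l = sign_imbalance l.
  exact: sum_maxchains (@tableau_sign_sublevels l).
split=> //; rewrite -alpha [RHS]mulr_sumr; apply: eq_bigr => c; exact: beta_chain.
Qed.
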